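(* Let $\mathfrak g$ and $\mathfrak h$ be two Lie algebras over a field $\mathbb K$ of characteristic zero, and let $(L,d,[\ ,\ ])$ be the associated differential graded Lie algebra $C_>(\mathfrak g\oplus\mathfrak h,\mathfrak h)$. Identify $Z^2_{nab}(\mathfrak g,\mathfrak h)$ with $MC(L)$ via $(\chi,\psi)\mapsto\chi+\psi$. Then the equivalence of cocycles in $Z^2_{nab}(\mathfrak g,\mathfrak h)$ coincides with gauge equivalence in $MC(L)$: two nonabelian 2-cocycles $(\chi,\psi)$ and $(\chi',\psi')$ are equivalent in $Z^2_{nab}(\mathfrak g,\mathfrak h)$ if and only if $\chi+\psi$ and $\chi'+\psi'$ are gauge equivalent in $MC(L)$.
   Context: **Nonabelian cocycles and their equivalence.** $Z^2_{nab}(\mathfrak g,\mathfrak h)$ is the set of pairs $(\chi,\psi)$ of linear maps $\chi:\mathfrak g\wedge\mathfrak g\to\mathfrak h$ and $\psi:\mathfrak g\to Der(\mathfrak h)$, $a\mapsto\psi_a$, such that for all $a,b,c\in\mathfrak g$: $[\psi_a,\psi_b]=\psi_{[a,b]}+ad_{\mathfrak h}(\chi(a\wedge b))$, and $\sum_{\circlearrowleft}\big(\psi_a\chi(b\wedge c)-\chi([a,b]\wedge c)\big)=0$ (sum over cyclic permutations of $a,b,c$). Two cocycles $(\chi,\psi)$, $(\chi',\psi')$ are equivalent iff there is a linear map $\beta:\mathfrak g\to\mathfrak h$ with $\psi'_a=\psi_a+ad^{\mathfrak h}_{\beta(a)}$ and $\chi'(a\wedge b)=\chi(a\wedge b)+\psi_a\beta(b)-\psi_b\beta(a)-\beta([a,b])+[\beta(a),\beta(b)]$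 for all $a,b\in\mathfrak g$. **Nijenhuis-Richardson bracket.** For a Lie algebra $\mathfrak l$ with bracket $\rho_{\mathfrak l}$, let $C^n(\mathfrak l,\mathfrak l)=\mathrm{Hom}(\wedge^n\mathfrak l,\mathfrak l)$, where an element of $C^{p+1}(\mathfrak l,\mathfrak l)$ has degree $p$. For $P$ of degree $p$ and $Q$ of degree $q$, $[P,Q]:=i_PQ-(-1)^{pq}i_QP$, with $i_PQ(l_0,\dots,l_{p+q}):=\sum_\sigma \mathrm{sign}(\sigma)\,Q(P(l_{\sigma(0)},\dots,l_{\sigma(p)}),l_{\sigma(p+1)},\dots,l_{\sigma(p+q)})$, sum over permutations $\sigma$ with $\sigma(0)<\dots<\sigma(p)$ and $\sigma(p+1)<\dots<\sigma(p+q)$. With $d:=[\rho_{\mathfrak l},\ ]$ this is a differential graded Lie algebra (dgLa). **The dgLa $L$.** Take $\mathfrak l=\mathfrak g\oplus\mathfrak h$ (direct sum of Lie algebras), so $d=[\rho_{\mathfrak g}+\rho_{\mathfrak h},\ ]$ with $\rho_{\mathfrak g},\rho_{\mathfrak h}$ the brackets of $\mathfrak g,\mathfrak h$. Using $\wedge^\bullet(\mathfrak g\oplus\mathfrak h)\simeq\wedge^\bullet\mathfrak g\otimes\wedge^\bullet\mathfrak h$, let $C^{m,n}=\mathrm{Hom}(\wedge^m\mathfrak g\otimes\wedge^n\mathfrak h,\mathfrak h)$, viewed inside $C^{m+n}(\mathfrak g\oplus\mathfrak h,\mathfrak g\oplus\mathfrak h)$, in degree $m+n-1$. Then $L=C_>(\mathfrak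 g\oplus\mathfrak h,\mathfrak h)=\bigoplus_{m\ge1,n\ge0}C^{m,n}$ is a sub-dgLa. Here $L^0=C^{1,0}=\mathrm{Hom}(\mathfrak g,\mathfrak h)$ and $L^1=C^{2,0}\oplus C^{1,1}$; $L^0$ is abelian and consists of ad-nilpotent elements. A pair $(\chi,\psi)$ is identified with $\chi+\psi\in L^1$, i.e. with the map $(g_1+h_1,g_2+h_2)\mapsto \chi(g_1,g_2)+\psi_{g_1}(h_2)-\psi_{g_2}(h_1)$; this identifies $Z^2_{nab}(\mathfrak g,\mathfrak h)$ with $MC(L)$. **Maurer-Cartan elements and gauge equivalence.** $MC(L)=\{\alpha\in L^1\mid d\alpha+\frac12[\alpha,\alpha]=0\}$. Elements $l,l'\in MC(L)$ are gauge equivalent iff there is an ad-nilpotent $\beta\in L^0$ (for every $x\in L$ some power of $ad_\beta=[\beta,\ ]$ kills $x$) with $l'=e^{ad_\beta}l+g_\beta$, where $g_\beta:=-\sum_{n\ge0}\frac1{(n+1)!}ad_\beta^n(d\beta)$. *)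

(* Defs.v *)
From HB Require Import structures.
From mathcomp Require Import all_boot all_order all_fingroup all_algebra.
From mathcomp Require Import all_classical.

Set Implicit Arguments.
Unset Strict Implicit.
Unset Printing Implicit Defensive.

Import GRing.Theory.
Local Open Scope classical_set_scope.
Local Open Scope ring_scope.

HB.mixin Record isLieAlgebra (K : fieldType) V of GRing.Lmodule K V := {
  lie : V -> V -> V;
  lie_linearl : forall y, linear (lie^~ y);
  lie_linearr : forall x, linear (lie x);
  liexx : forall x, lie x x = 0;
  lie_jacobi : forall x y z,
    lie x (lie y z) + lie y (lie z x) + lie z (lie x y) = 0
}.

#[short(type="lieAlgType")]
HB.structure Definition LieAlgebra (K : fieldType) :=
  {V of isLieAlgebra K V & GRing.Lmodule K V}.

Notation "[lie x , y ]" := (lie x y)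
  (at level 0, x, y at level 99, format "[lie  x ,  y ]") : ring_scope.

Section DirectSum.
Variables (K : fieldType) (g h : lieAlgType K).

Definition sum_lie (x y : g * h) : g * h := ([lie x.1, y.1], [lie x.2, y.2]).

Fact sum_lie_linearl y : linear (sum_lie^~ y).
Proof. by move=> a u v; rewrite /sum_lie /= !lie_linearl. Qed.

Fact sum_lie_linearr x : linear (sum_lie x).
Proof. by move=> a u v; rewrite /sum_lie /= !lie_linearr. Qed.

Fact sum_liexx x : sum_lie x x = 0.
Proof. by rewrite /sum_lie !liexx. Qed.

Fact sum_lie_jacobi x y z :
  sum_lie x (sum_lie y z) + sum_lie y (sum_lie z x)
    + sum_lie z (sum_lie x y) = 0.
Proof.
by apply/eqP; rewrite -pair_eqE; apply/andP; split; apply/eqP;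
  exact: lie_jacobi.
Qed.

HB.instance Definition _ := isLieAlgebra.Build K (g * h)%type
  sum_lie_linearl sum_lie_linearr sum_liexx sum_lie_jacobi.

End DirectSum.

Section Cocycles.
Variables (K : fieldType) (g h : lieAlgType K).

Definition derivation (D : h -> h) : Prop :=
  linear D /\ forall x y, D [lie x, y] = [lie D x, y] + [lie x, D y].

Record Z2nab (chi : g -> g -> h) (psi : g -> h -> h) : Prop := {
  chi_linearl : forall b, linear (chi^~ b);
  chi_linearr : forall a, linear (chi a);
  chi_alt : forall a, chi a a = 0;
  psi_linear : forall x, linear (psi^~ x);
  psi_der : forall a, derivation (psi a);
  psi_comm : forall a b x,
    psi a (psi b x) - psi b (psi a x) = psi [lie a, b] x + [lie chi a b, x];
  chi_cyclic : forall a b c,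
    (psi a (chi b c) - chi [lie a, b] c) + (psi b (chi c a) - chi [lie b, c] a)
      + (psi c (chi a b) - chi [lie c, a] b) = 0
}.

Definition Z2nab_equiv (chi : g -> g -> h) (psi : g -> h -> h)
    (chi' : g -> g -> h) (psi' : g -> h -> h) : Prop :=
  exists beta : {linear g -> h},
    (forall a x, psi' a x = psi a x + [lie beta a, x]) /\
    (forall a b, chi' a b = chi a b + psi a (beta b) - psi b (beta a)
                            - beta [lie a, b] + [lie beta a, beta b]).

End Cocycles.

(* [cochain U k] is the carrier of degree k, i.e. arity k.+1. Arity 0 (degree
   -1) is left out: L lives in arities >= 1. Multilinearity and alternation
   are imposed where the subspaces C^{m,n} are defined. *)
Definition cochain (U : Type) (k : nat) := ('I_k.+1 -> U) -> U.

(* [cochains U] is the product of all degrees; the direct sum L is cut out in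
   it by a finite support condition. *)
Definition cochains (U : Type) := forall k, cochain U k.

Section CochainsLmodule.
Variables (K : fieldType) (U : lmodType K).

HB.instance Definition _ := gen_eqMixin (cochains U).
HB.instance Definition _ := gen_choiceMixin (cochains U).

Implicit Types x y z : cochains U.

Definition cochains_zero : cochains U := fun k => 0.
Definition cochains_opp x : cochains U := fun k => - x k.
Definition cochains_add x y : cochains U := fun k => x k + y k.
Definition cochains_scale (a : K) x : cochains U := fun k v => a *: x k v.

Fact cochains_addA : associative cochains_add.
Proof. by move=> x y z; apply: functional_extensionality_dep => k; exact: addrA. Qed.
Fact cochains_addC : commutative cochains_add.
Proof. by move=> x y; apply: functional_extensionality_dep => k; exact: addrC. Qed.
Fact cochains_add0 : left_id cochains_zero cochains_add.
Proof. by move=> x; apply: functional_extensionality_dep => k; exact: add0r. Qed.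
Fact cochains_addN : left_inverse cochains_zero cochains_opp cochains_add.
Proof. by move=> x; apply: functional_extensionality_dep => k; exact: addNr. Qed.

HB.instance Definition _ := GRing.isZmodule.Build (cochains U)
  cochains_addA cochains_addC cochains_add0 cochains_addN.

Fact cochains_scaleA a b x :
  cochains_scale a (cochains_scale b x) = cochains_scale (a * b) x.
Proof.
apply: functional_extensionality_dep => k; apply/funext => v.
exact: scalerA.
Qed.
Fact cochains_scale1 : left_id 1 cochains_scale.
Proof.
move=> x; apply: functional_extensionality_dep => k; apply/funext => v.
exact: scale1r.
Qed.
Fact cochains_scaleDr : right_distributive cochains_scale +%R.
Proof.
move=> a x y; apply: functional_extensionality_dep => k; apply/funext => v.
exact: scalerDr.
Qed.
Fact cochains_scaleDl x : {morph cochains_scale^~ x : a b / a + b}.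
Proof.
move=> a b; apply: functional_extensionality_dep => k; apply/funext => v.
exact: scalerDl.
Qed.

HB.instance Definition _ := GRing.Zmodule_isLmodule.Build K (cochains U)
  cochains_scaleA cochains_scale1 cochains_scaleDr cochains_scaleDl.

End CochainsLmodule.

(* The homogeneous element with component f in degree k. *)
Definition homog (K : fieldType) (U : lmodType K) k (f : cochain U k) :
  cochains U := @dfwith nat (cochain U) (0 : cochains U) k f.
Arguments homog {K U} k f _ _.

(* sigma 0 < ... < sigma (m - 1) and sigma m < ... < sigma (n - 1) *)
Definition is_shuffle (m n : nat) (sigma : 'S_n) : bool :=
  [forall i : 'I_n, forall j : 'I_n,
    [&& (i < j)%N & ((j < m) || (m <= i))%N] ==> (sigma i < sigma j)%N].

Section NijenhuisRichardson.
Variables (K : fieldType) (U : lmodType K).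

(* i_P Q for P of degree p and Q of degree q; n always stands for p + q, and
   being a separate argument it makes i_P Q and i_Q P live in the same type. *)
Definition nr_insert (p q n : nat) (P : cochain U p) (Q : cochain U q) :
  cochain U n := fun l =>
  \sum_(sigma : 'S_n.+1 | is_shuffle p.+1 sigma)
    (-1) ^+ sigma *:
    Q (fun j : 'I_q.+1 =>
         if j == ord0 then P (fun i : 'I_p.+1 => l (sigma (inord i)))
         else l (sigma (inord (p + j)))).

Definition nr_hbracket (p q n : nat) (P : cochain U p) (Q : cochain U q) :
  cochain U n := fun l =>
  @nr_insert p q n P Q l - (-1) ^+ (p * q) *: @nr_insert q p n Q P l.

Definition nr_bracket (x y : cochains U) : cochains U := fun n =>
  \sum_(p < n.+1) nr_hbracket (x p) (y (n - p)%N).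

End NijenhuisRichardson.

Arguments nr_insert {K U p q} n P Q l.
Arguments nr_hbracket {K U p q} n P Q l.
Arguments nr_bracket {K U} x y _ _.

Definition lie_cochain (K : fieldType) (l : lieAlgType K) : cochains l :=
  homog 1 (fun v : 'I_2 -> l => [lie v ord0, v ord_max]).
Arguments lie_cochain {K} l _ _.

Definition nr_diff (K : fieldType) (l : lieAlgType K) (x : cochains l) :
  cochains l := nr_bracket (lie_cochain l) x.
Arguments nr_diff {K l} x _ _.

Definition alt_multilinear (K : fieldType) (U V : lmodType K) (n : nat)
    (f : ('I_n -> U) -> V) : Prop :=
  (forall (v : 'I_n -> U) (i : 'I_n),
     linear (fun u : U => f (@dfwith _ (fun=> U) v i u))) /\
  (forall (v : 'I_n -> U) (i j : 'I_n), i != j -> v i = v j -> f v = 0).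

Section DgLa.
Variables (K : fieldType) (g h : lieAlgType K).

(* C^{m,n} = Hom(/\^m g (x) /\^n h, h) *)
Definition bicochain (m n : nat) : set (('I_m -> g) -> ('I_n -> h) -> h) :=
  [set c | (forall y, alt_multilinear (c^~ y)) /\
           (forall x, alt_multilinear (c x))].

(* The inclusion of C^{m,n} in C^{m+n}(g + h, g + h) given by the isomorphism
   /\(g + h) ~ /\g (x) /\h; k.+1 always stands for m + n. *)
Definition bicochain_incl (m n k : nat)
    (c : ('I_m -> g) -> ('I_n -> h) -> h) : cochain (g * h)%type k := fun l =>
  (0, \sum_(sigma : 'S_k.+1 | is_shuffle m sigma)
        (-1) ^+ sigma *:
        c (fun i : 'I_m => (l (sigma (inord i))).1)
          (fun j : 'I_n => (l (sigma (inord (m + j)))).2)).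

(* Degree k of L is the sum of the C^{m,n} with m >= 1 and m + n = k.+1; the
   index m below is the number of arguments in g minus 1. *)
Definition dgla_component (k : nat) : set (cochain (g * h)%type k) :=
  [set f | exists c : forall m : 'I_k.+1,
               ('I_m.+1 -> g) -> ('I_(k - m) -> h) -> h,
             (forall m, bicochain (c m)) /\
             f = \sum_(m < k.+1) bicochain_incl (c m)].

Definition dgla : set (cochains (g * h)%type) :=
  [set x | (forall k, dgla_component (x k)) /\
           exists N, forall k, (N <= k)%N -> x k = 0].

Definition dgla_deg (k : nat) : set (cochains (g * h)%type) :=
  [set x | dgla x /\ forall j, j != k -> x j = 0].

Definition MC : set (cochains (g * h)%type) :=
  [set a | dgla_deg 1 a /\
           nr_diff a + 2%:R^-1 *: nr_bracket a a = 0].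

Definition ad_nilpotent (b : cochains (g * h)%type) : Prop :=
  forall x, dgla x -> exists n, iter n (nr_bracket b) x = 0.

(* [\sum_(n \in setT)] is the sum of a finitely supported family, as the two
   families below are when b is ad-nilpotent. *)
Definition exp_ad (b x : cochains (g * h)%type) : cochains (g * h)%type :=
  \sum_(n \in [set: nat]) (n`!%:R^-1 *: iter n (nr_bracket b) x).

Definition gauge_term (b : cochains (g * h)%type) : cochains (g * h)%type :=
  - \sum_(n \in [set: nat])
      (n.+1`!%:R^-1 *: iter n (nr_bracket b) (nr_diff b)).

Definition gauge_equiv (a a' : cochains (g * h)%type) : Prop :=
  [/\ MC a, MC a' &
      exists b, [/\ dgla_deg 0 b, ad_nilpotent b &
                    a' = exp_ad b a + gauge_term b]].

(* chi + psi *)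
Definition cocycle_cochain (chi : g -> g -> h) (psi : g -> h -> h) :
  cochains (g * h)%type :=
  homog 1 (fun v : 'I_2 -> (g * h)%type =>
    (0, chi (v ord0).1 (v ord_max).1
        + psi (v ord0).1 (v ord_max).2 - psi (v ord_max).1 (v ord0).2)).

End DgLa.

(* Main.v *)
(* Sending an argument in g to h by beta and evaluating again kills everything
   that takes only arguments in g, so both exponential series stop early:
   ad_beta^2 (chi + psi) = 0 and ad_beta^2 (d beta) = 0. Hence the gauge action
   of beta is chi + psi + [beta, chi + psi] - d beta - 1/2 [beta, d beta], and its
   C^{2,0} and C^{1,1} parts are the two formulas defining equivalence of
   cocycles. Conversely every element of L^0 = C^{1,0} is a linear map beta, and
   the two parts are recovered by evaluating at pairs of pure arguments. *)
Require Import Defs.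
From HB Require Import structures.
From mathcomp Require Import all_boot all_order all_fingroup all_algebra.
From mathcomp Require Import all_classical.

Set Implicit Arguments.
Unset Strict Implicit.
Unset Printing Implicit Defensive.

Import GRing.Theory.
Local Open Scope classical_set_scope.
Local Open Scope ring_scope.

(** * Shuffles whose second block has size zero or one *)

Section Shuffles.

(** A strictly increasing map lists its image in sorted order, and a finite set has only one such
    listing. *)
Lemma increasing_codom_inj (m n : nat) (f1 f2 : 'I_m -> 'I_n) :
  {homo f1 : i j / (i < j)%N} -> {homo f2 : i j / (i < j)%N} ->
  codom f1 =i codom f2 -> f1 =1 f2.
Proof.
move=> f1_incr f2_incr eq_codom.
have enum_lt : sorted (fun i j : 'I_m => (i < j)%N) (enum 'I_m).
  by rewrite -(sorted_map (f := val) (e' := ltn)) val_enum_ord iota_ltn_sorted.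
have/eq_in_map eq_f : codom f1 = codom f2.
  apply: (@irr_sorted_eq _ (fun i j : 'I_n => (i < j)%N)) => //.
  - by move=> i j k; apply: ltn_trans.
  - by move=> i; rewrite /= ltnn.
  - exact: homo_sorted f1_incr _ enum_lt.
  - exact: homo_sorted f2_incr _ enum_lt.
by move=> i; apply: eq_f; rewrite mem_enum.
Qed.

Lemma is_shuffle_full (n : nat) (sigma : 'S_n) :
  is_shuffle n sigma = (sigma == 1%g).
Proof.
apply/idP/eqP => [/'forall_forallP sh | ->]; last first.
  apply/'forall_forallP => i j; apply/implyP.
  by rewrite !perm1 => /andP[].
apply/permP; apply: increasing_codom_inj.
- by move=> i j ij; apply: (implyP (sh i j)); rewrite ij ltn_ord.
- by move=> i j; rewrite !perm1.
(* Both images are everything, since permutations are surjective. *)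
- move=> i; have onto (tau : 'S_n) : i \in codom tau.
    by rewrite -(permKV tau i) codom_f.
  by rewrite !onto.
Qed.

Lemma ltn_lift (n : nat) (h : 'I_n.+1) : {homo lift h : i j / (i < j)%N}.
Proof.
by move=> i j ij; rewrite !ltnNge /= leq_bump2 -ltnNge.
Qed.

(** The image of the last index determines the shuffle: the first [n] indices must enumerate its
    complement increasingly, which is what [lift] does. *)
Lemma is_shuffle_last (n : nat) (sigma : 'S_n.+1) :
  is_shuffle n sigma = (sigma == lift_perm ord_max (sigma ord_max) 1%g).
Proof.
apply/idP/eqP => [/'forall_forallP sh | ->]; last first.
  apply/'forall_forallP => i j; apply/implyP => /andP[ij jn].
  have lt_jn : (j < n)%N.
    case/orP: jn => // le_ni.
    by have:= leq_trans ij (leq_ord j); rewrite ltnNge le_ni.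
  have liftE (k : 'I_n.+1) (kn : (k < n)%N) : k = lift ord_max (Ordinal kn).
    by apply: ord_inj; rewrite lift_max.
  rewrite (liftE _ lt_jn) (liftE _ (ltn_trans ij lt_jn)) !lift_perm_lift !perm1.
  exact: ltn_lift.
have eq_lift : sigma \o lift ord_max =1 lift (sigma ord_max).
  apply: increasing_codom_inj; last 1 first.
  - move=> i; apply/codomP/codomP => [[k ->] | [k ->]] /=.
      have /unlift_some[k' -> _] : sigma ord_max != sigma (lift ord_max k).
        by rewrite (inj_eq perm_inj) neq_lift.
      by exists k'.
    have : ord_max != (sigma^-1)%g (lift (sigma ord_max) k).
      by rewrite -(inj_eq (@perm_inj _ sigma)) permKV neq_lift.
    case/unlift_some=> k' eq_k' _; exists k'.
    by rewrite /= -eq_k' permKV.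
  - move=> i j ij /=; apply: (implyP (sh _ _)).
    by rewrite !lift_max ij ltn_ord.
  - exact: ltn_lift.
apply/permP => i; have [k ->|->] := unliftP ord_max i.
  by rewrite lift_perm_lift perm1 -eq_lift.
by rewrite lift_perm_id.
Qed.

Lemma sum_shuffle_full (V : nmodType) (n : nat) (F : 'S_n -> V) :
  \sum_(sigma | is_shuffle n sigma) F sigma = F 1%g.
Proof.
by rewrite (eq_bigl (pred1 1%g)) ?big_pred1_eq // => s; rewrite is_shuffle_full.
Qed.

Lemma sum_shuffle_last (V : nmodType) (n : nat) (F : 'S_n.+1 -> V) :
  \sum_(sigma | is_shuffle n sigma) F sigma =
  \sum_(i < n.+1) F (lift_perm ord_max i 1%g).
Proof.
rewrite (reindex (fun i : 'I_n.+1 => lift_perm ord_max i 1%g)) /=.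
  by apply: eq_bigl => i; rewrite is_shuffle_last lift_perm_id eqxx.
exists (fun sigma : 'S_n.+1 => sigma ord_max) => [i _ | sigma].
  by rewrite lift_perm_id.
by rewrite inE is_shuffle_last => /eqP <-.
Qed.

Lemma lift_perm_max_inord (n : nat) (i : 'I_n.+1) (k : 'I_n) :
  lift_perm ord_max i 1%g (inord k) = lift i k.
Proof.
have -> : inord k = lift ord_max k.
  by apply: ord_inj; rewrite lift_max /= inordK // ltnS ltnW.
by rewrite lift_perm_lift perm1.
Qed.

Lemma lift_perm_max_inord_max (n : nat) (i : 'I_n.+1) :
  lift_perm ord_max i 1%g (inord n) = i.
Proof. by rewrite (_ : inord n = ord_max) ?lift_perm_id //; apply: val_inj; rewrite /= inordK. Qed.

End Shuffles.

(** * Nijenhuis-Richardson brackets in low degree *)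

Section Brackets.
Variables (K : fieldType) (U : lmodType K).

Definition cochain1 (b : U -> U) : cochain U 0 := fun v => b (v ord0).

Definition cochain2 (f : U -> U -> U) : cochain U 1 :=
  fun v => f (v ord0) (v ord_max).

(** Cochains are raw functions, so [nr_insert n 0 Q] still evaluates [Q], on a tuple whose first
    entry is 0. This trace of multilinearity is what makes brackets with 0 vanish. *)
Definition normalized (k : nat) (P : cochain U k) : Prop :=
  forall v i, v i = 0 -> P v = 0.

Lemma normalized_cochain1 b : b 0 = 0 -> normalized (cochain1 b).
Proof. by move=> b0 v i; rewrite [i]ord1 /cochain1 => ->. Qed.

Lemma normalized_cochain2 f :
  (forall y, f 0 y = 0) -> (forall x, f x 0 = 0) -> normalized (cochain2 f).
Proof.
move=> f0 f0' v i vi0; rewrite /cochain2.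
case: (unliftP ord_max i) vi0 => [j|] -> vi0; last by rewrite vi0.
by move: vi0; rewrite [j]ord1 (_ : lift _ _ = ord0) => [->//|]; apply: ord_inj.
Qed.

Lemma homogE k (f : cochain U k) : homog k f k = f.
Proof. exact: dfwithin. Qed.

Lemma homog_neq k j (f : cochain U k) : j != k -> homog k f j = 0.
Proof. by rewrite eq_sym => jk; rewrite /homog dfwithout. Qed.

Lemma homog0 k : homog k (0 : cochain U k) = 0.
Proof.
apply: functional_extensionality_dep => j; have [->|jk] := eqVneq j k.
  by rewrite homogE.
by rewrite homog_neq.
Qed.

Lemma homogD k (f1 f2 : cochain U k) :
  homog k (f1 + f2) = homog k f1 + homog k f2.
Proof.
apply: functional_extensionality_dep => j.
change (homog k (f1 + f2) j = homog k f1 j + homog k f2 j).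
have [->|jk] := eqVneq j k; first by rewrite !homogE.
by rewrite !homog_neq // addr0.
Qed.

Lemma homogN k (f : cochain U k) : homog k (- f) = - homog k f.
Proof. by apply/eqP; rewrite -addr_eq0 -homogD addNr homog0. Qed.

Lemma homogZ k a (f : cochain U k) :
  homog k (fun v => a *: f v) = a *: homog k f.
Proof.
apply: functional_extensionality_dep => j; apply/funext => v.
change (homog k (fun v => a *: f v) j v = a *: homog k f j v).
have [jk|jk] := eqVneq j k; last by rewrite !homog_neq // scaler0.
by move: v; rewrite jk => v; rewrite !homogE.
Qed.

Lemma homog_inj k : injective (@homog K U k).
Proof. by move=> f1 f2 eq_f; rewrite -(homogE f1) eq_f homogE. Qed.

Lemma nr_insert0l p q n (Q : cochain U q) :
  normalized Q -> nr_insert n (0 : cochain U p) Q = 0.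
Proof.
by move=> Q0; apply/funext => l; apply: big1 => s _; rewrite (Q0 _ ord0) ?scaler0.
Qed.

Lemma nr_insert0r p q n (P : cochain U p) :
  nr_insert n P (0 : cochain U q) = 0.
Proof. by apply/funext => l; apply: big1 => s _; rewrite scaler0. Qed.

Lemma nr_hbracket0l p q n (Q : cochain U q) :
  normalized Q -> nr_hbracket n (0 : cochain U p) Q = 0.
Proof.
move=> Q0; apply/funext => l.
by rewrite /nr_hbracket nr_insert0l // nr_insert0r scaler0 subr0.
Qed.

Lemma nr_hbracket0r p q n (P : cochain U p) :
  normalized P -> nr_hbracket n P (0 : cochain U q) = 0.
Proof.
move=> P0; apply/funext => l.
by rewrite /nr_hbracket nr_insert0l // nr_insert0r scaler0 subr0.
Qed.

Lemma normalized_homog k j (f : cochain U k) :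
  normalized f -> normalized (homog k f j).
Proof.
by move=> f0; have [->|jk] := eqVneq j k; rewrite ?homogE ?homog_neq.
Qed.

Lemma nr_bracket_homog p q (P : cochain U p) (Q : cochain U q) :
  normalized P -> normalized Q ->
  nr_bracket (homog p P) (homog q Q) = homog (p + q) (nr_hbracket (p + q) P Q).
Proof.
move=> P0 Q0; apply: functional_extensionality_dep => n; rewrite /nr_bracket.
have [->|npq] := eqVneq n (p + q)%N.
  rewrite (bigD1 (Ordinal (leq_addr q p : (p < (p + q).+1)%N))) //=.
  rewrite big1 ?addr0 => [|i ip]; first by rewrite homogE addKn !homogE.
  by rewrite [homog p P i]homog_neq ?nr_hbracket0l //; apply: normalized_homog.
(* Off degree [p + q], every summand has a zero factor: the right one if [i = p], since then [n - i]
   differs from [q], and the left one otherwise. *)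
rewrite homog_neq // big1 // => i _; have [ip|ip] := eqVneq (i : nat) p.
  rewrite [X in nr_hbracket _ _ X]homog_neq.
    by apply: nr_hbracket0r; apply: normalized_homog.
  by apply: contraNneq npq => <-; rewrite -ip subnKC ?leq_ord.
by rewrite [homog p P i]homog_neq ?nr_hbracket0l //; apply: normalized_homog.
Qed.

(** Both permutations of two letters are (1,1)-shuffles; the transposition brings the minus sign. *)
Lemma nr_insert01 b f :
  nr_insert 1 (cochain1 b) (cochain2 f) =
  cochain2 (fun x y => f (b x) y - f (b y) x).
Proof.
apply/funext => l; rewrite /nr_insert (@sum_shuffle_last _ 1) !big_ord_recl big_ord0.
rewrite !odd_lift_perm !odd_perm1 /= /cochain1 /cochain2 /=.
rewrite !(@lift_perm_max_inord_max 1) !(@lift_perm_max_inord 1 _ ord0).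
rewrite expr1 expr0 scale1r scaleN1r addr0 addrC.
by congr (f (b (l _)) (l _) - f (b (l _)) (l _)); apply: ord_inj.
Qed.

Lemma nr_insert10 b f :
  nr_insert 1 (cochain2 f) (cochain1 b) = cochain2 (fun x y => b (f x y)).
Proof.
apply/funext => l; rewrite /nr_insert (@sum_shuffle_full _ 2) odd_perm1 expr0 scale1r.
by rewrite /cochain1 /cochain2 !perm1; congr (b (f (l _) (l _))); apply: ord_inj;
  rewrite inordK.
Qed.

(** The three (2,1)-shuffles are indexed by the argument left outside [f1]; its position gives the
    sign. *)
Lemma nr_insert11 f1 f2 (l : 'I_3 -> U) (x := l ord0)
    (y := l (lift ord0 ord0)) (z := l ord_max) :
  nr_insert 2 (cochain2 f1) (cochain2 f2) l =
  f2 (f1 x y) z - f2 (f1 x z) y + f2 (f1 y z) x.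
Proof.
rewrite /nr_insert (@sum_shuffle_last _ 2) !big_ord_recl big_ord0.
rewrite !odd_lift_perm !odd_perm1 /= /cochain2 /=.
rewrite !(@lift_perm_max_inord_max 2) !(@lift_perm_max_inord 2 _ ord0).
rewrite !(@lift_perm_max_inord 2 _ ord_max).
rewrite expr1 expr0 !scale1r scaleN1r addr0.
rewrite addrC [- _ + _]addrC /x /y /z.
by congr (f2 (f1 (l _) (l _)) (l _) - f2 (f1 (l _) (l _)) (l _)
          + f2 (f1 (l _) (l _)) (l _)); apply: ord_inj.
Qed.

Lemma nr_hbracket01 b f :
  nr_hbracket 1 (cochain1 b) (cochain2 f) =
  cochain2 (fun x y => f (b x) y - f (b y) x - b (f x y)).
Proof.
by apply/funext => l; rewrite /nr_hbracket nr_insert01 nr_insert10 scale1r.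
Qed.

Lemma nr_hbracket10 b f :
  nr_hbracket 1 (cochain2 f) (cochain1 b) =
  cochain2 (fun x y => b (f x y) - (f (b x) y - f (b y) x)).
Proof.
by apply/funext => l; rewrite /nr_hbracket nr_insert01 nr_insert10 scale1r.
Qed.

(** For two cochains of degree 1 the sign [(-1) ^+ (1 * 1)] turns the difference into a sum. *)
Lemma nr_hbracket11 f1 f2 (l : 'I_3 -> U) :
  nr_hbracket 2 (cochain2 f1) (cochain2 f2) l =
  nr_insert 2 (cochain2 f1) (cochain2 f2) l
  + nr_insert 2 (cochain2 f2) (cochain2 f1) l.
Proof. by rewrite /nr_hbracket mul1n expr1 scaleN1r opprK. Qed.

End Brackets.

(* Bubbles the opposite of the head of a right-nested sum next to it. *)
Ltac zmod_cancel :=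
  rewrite ?opprD ?opprK -?addrA -[LHS]addr0 -?addrA;
  repeat match goal with
  | |- - ?x + (?x + _) = _ => rewrite (addKr x)
  | |- ?x + (- ?x + _) = _ => rewrite (addNKr x)
  | |- - ?x + _ = _ => rewrite (addrCA _ x)
  | |- ?x + _ = _ => rewrite (addrCA _ (- x))
  end; rewrite ?addr0.

(** Cocycles are bare functions with a [linear] hypothesis; this packages the usual additive rules
    as one rewrite rule for them. *)
Lemma linear_zmodE (K : fieldType) (U V : lmodType K) (f : U -> V) :
  linear f ->
  (f 0 = 0) * (forall x, f (- x) = - f x) * (forall x y, f (x + y) = f x + f y).
Proof.
move=> lf; pose F : {linear U -> V} := HB.pack f (GRing.isLinear.Build _ _ _ _ f lf).
by split; [split => [|x] | move=> x y];
  rewrite -[f]/(F : U -> V) ?linear0 ?linearN ?linearD.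
Qed.

(** * Elementary Lie bracket identities *)

Section LieTheory.
Variables (K : fieldType) (l : lieAlgType K).
Implicit Types x y : l.

Lemma lie0x x : [lie 0, x] = 0.
Proof. by rewrite (linear_zmodE (lie_linearl x)). Qed.

Lemma liex0 x : [lie x, 0] = 0.
Proof. by rewrite (linear_zmodE (lie_linearr x)). Qed.

Lemma lieDl x y z : [lie x + y, z] = [lie x, z] + [lie y, z].
Proof. by rewrite (linear_zmodE (lie_linearl z)). Qed.

Lemma lieDr x y z : [lie x, y + z] = [lie x, y] + [lie x, z].
Proof. by rewrite (linear_zmodE (lie_linearr x)). Qed.

Lemma lieNl x y : [lie - x, y] = - [lie x, y].
Proof. by rewrite (linear_zmodE (lie_linearl y)). Qed.

Lemma lieC x y : [lie x, y] = - [lie y, x].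
Proof.
apply/eqP; rewrite -addr_eq0 -(liexx (x + y)) lieDl !lieDr !liexx.
by rewrite add0r addr0.
Qed.

Lemma normalized_lie : normalized (cochain2 (@lie K l)).
Proof. by apply: normalized_cochain2; [exact: lie0x | exact: liex0]. Qed.

End LieTheory.

(** * Alternating multilinear maps of arity at most two *)

Section AltMultilinear.
Variables (K : fieldType) (U V : lmodType K).

Lemma alt_multilinear0 (f : ('I_0 -> U) -> V) : alt_multilinear f.
Proof. by split=> [v []|v []]. Qed.

Lemma alt_multilinear1 (f : U -> V) :
  linear f -> alt_multilinear (fun v : 'I_1 -> U => f (v ord0)).
Proof.
move=> lf; split=> [v i a x y | v i j]; last by rewrite !ord1 eqxx.
by rewrite [i]ord1 !dfwithin lf.
Qed.

Lemma alt_multilinear2 (f : U -> U -> V) :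
  (forall y, linear (f^~ y)) -> (forall x, linear (f x)) ->
  (forall x, f x x = 0) ->
  alt_multilinear (fun v : 'I_2 -> U => f (v ord0) (v ord_max)).
Proof.
move=> lf lf' falt.
have I2 (i : 'I_2) : i = ord0 \/ i = ord_max.
  by case: i => [[|[|//]] lt_i2]; [left | right]; apply: ord_inj.
split=> [v i a x y | v i j].
  have [->|->] := I2 i; rewrite !dfwithin.
    by rewrite !(@dfwithout _ (fun=> U) v ord0 _ ord_max) // lf.
  by rewrite !(@dfwithout _ (fun=> U) v ord_max _ ord0) // lf'.
by have [->|->] := I2 i; have [->|->] := I2 j; rewrite ?eqxx // => _ ->.
Qed.

End AltMultilinear.

(** * Nonabelian cocycles as Maurer-Cartan elements *)

Section Cocycles.
Variables (K : fieldType) (g h : lieAlgType K).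
Implicit Types (chi : g -> g -> h) (psi : g -> h -> h).

Lemma dgla_component0 k : dgla_component (0 : cochain (g * h)%type k).
Proof.
exists (fun _ _ _ => 0); split=> [m|].
  by split=> z; split=> // v i a x y; rewrite scaler0 addr0.
apply/funext => l; rewrite fct_sumE; symmetry; apply: big1 => m _.
rewrite /bicochain_incl big1 // => s _.
by rewrite scaler0.
Qed.

Lemma dgla_deg_homog k (f : cochain (g * h)%type k) :
  dgla_component f -> dgla_deg k (homog k f).
Proof.
move=> Lf; split=> [|j jk]; last exact: homog_neq.
split=> [j|].
  have [->|jk] := eqVneq j k; first by rewrite homogE.
  by rewrite homog_neq //; apply: dgla_component0.
by exists k.+1 => j kj; apply: homog_neq; rewrite gtn_eqF.
Qed.

Definition cocycle_map chi psi (x y : g * h) : g * h :=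
  (0, chi x.1 y.1 + psi x.1 y.2 - psi y.1 x.2).

Lemma cocycle_cochainE chi psi :
  cocycle_cochain chi psi = homog 1 (cochain2 (cocycle_map chi psi)).
Proof. by []. Qed.

Lemma dgla_component_cocycle chi psi :
  Z2nab chi psi -> dgla_component (cochain2 (cocycle_map chi psi)).
Proof.
(* The index is the number of arguments in [g] minus one, so [psi] in C^{1,1} sits at 0 and [chi] in
   C^{2,0} at 1. *)
move=> Z; pose c (m : nat) : ('I_m.+1 -> g) -> ('I_(1 - m) -> h) -> h :=
  match m with
  | 0 => fun x y => psi (x ord0) (y (ord0 : 'I_1))
  | 1 => fun x _ => chi (x ord0) (x ord_max)
  | _ => fun _ _ => 0
  end.
exists (fun m : 'I_2 => @c m); split=> [[[|[|//]] lt_m2]|].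
- split=> [y|x]; first exact: (alt_multilinear1 (psi_linear Z (y ord0))).
  exact: (alt_multilinear1 (psi_der Z (x ord0)).1).
- split=> [y|x]; last exact: alt_multilinear0.
  exact: (alt_multilinear2 (chi_linearl Z) (chi_linearr Z) (chi_alt Z)).
apply/funext => l; rewrite fct_sumE !big_ord_recl big_ord0 addr0.
rewrite /bicochain_incl (@sum_shuffle_last _ 1) (@sum_shuffle_full _ 2).
rewrite !big_ord_recl big_ord0 !odd_lift_perm !odd_perm1 /= !perm1.
rewrite !(@lift_perm_max_inord_max 1) !(@lift_perm_max_inord 1 _ ord0).
rewrite expr1 expr0 !scale1r scaleN1r addr0.
rewrite /cochain2 /cocycle_map.
apply/eqP; rewrite -pair_eqE /= addr0 eqxx /=; apply/eqP.
rewrite [RHS]addrC [- _ + _]addrC addrA.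
by congr (chi (l _).1 (l _).1 + psi (l _).1 (l _).2 - psi (l _).1 (l _).2);
  apply: ord_inj; rewrite ?inordK.
Qed.

Lemma normalized_cocycle_map chi psi :
  Z2nab chi psi -> normalized (cochain2 (cocycle_map chi psi)).
Proof.
move=> Z; apply: normalized_cochain2 => [y|x]; rewrite /cocycle_map /=.
  rewrite (linear_zmodE (chi_linearl Z _)) (linear_zmodE (psi_linear Z _)).
  by rewrite (linear_zmodE (psi_der Z _).1) addr0 subr0.
rewrite (linear_zmodE (chi_linearr Z _)) (linear_zmodE (psi_linear Z _)).
by rewrite (linear_zmodE (psi_der Z _).1) addr0 subr0.
Qed.

(** With rho the bracket of g + h, the three groups are i_rho a, i_a rho and i_a a, which add up to
    d a + 1/2 [a, a]. Three arguments in [g] give [chi_cyclic], two give [psi_comm], and one gives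
    the derivation rule for [psi]. *)
Lemma cocycle_MC_identity chi psi (x y z : g * h) :
  Z2nab chi psi ->
  let a := cocycle_map chi psi in
  (a [lie x, y] z - a [lie x, z] y + a [lie y, z] x)
  + ([lie a x y, z] - [lie a x z, y] + [lie a y z, x])
  + (a (a x y) z - a (a x z) y + a (a y z) x) = 0.
Proof.
move=> Z a.
have chi0 u : chi 0 u = 0 by rewrite (linear_zmodE (chi_linearl Z u)).
have psi0 u : psi 0 u = 0 by rewrite (linear_zmodE (psi_linear Z u)).
have psiD u v w : psi u (v + w) = psi u v + psi u w.
  by rewrite (linear_zmodE (psi_der Z u).1).
have psiN u v : psi u (- v) = - psi u v.
  by rewrite (linear_zmodE (psi_der Z u).1).
have psi_lie u v w : psi [lie u, v] w
    = psi u (psi v w) - psi v (psi u w) - [lie chi u v, w].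
  by rewrite (psi_comm Z) addrK.
have chiN u v w : chi [lie u, v] w = - chi [lie v, u] w.
  by rewrite (lieC u) (linear_zmodE (chi_linearl Z w)).
have chiC u v : chi u v = - chi v u.
  apply/eqP; rewrite -addr_eq0 -(chi_alt Z (u + v)).
  rewrite (linear_zmodE (chi_linearl Z _)) !(linear_zmodE (chi_linearr Z _)).
  by rewrite !(chi_alt Z) add0r addr0.
(* Shuffles list pairs in increasing order, so the cyclic identity is rewritten with the pair (x, z)
   instead of (z, x). *)
have cyc := chi_cyclic Z x.1 y.1 z.1.
rewrite (chiC z.1 x.1) (chiN z.1 x.1) psiN opprK in cyc.
apply/eqP; rewrite -pair_eqE /=; apply/andP; split; apply/eqP.
  by rewrite !lie0x !(subr0, addr0).
rewrite /= !chi0 !psi0 !add0r !(psiD, psiN) !(lieDl, lieNl).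
rewrite !psi_lie !(psi_der Z _).2.
rewrite (lieC x.2 (psi z.1 y.2)) (lieC x.2 (psi y.1 z.2)) (lieC y.2 (psi x.1 z.2)).
(* The terms with all arguments in [g] form minus the cyclic sum, so the 0 on the right is replaced
   by that. *)
rewrite -[RHS]oppr0 -cyc; apply/eqP; rewrite -subr_eq0; apply/eqP.
by zmod_cancel.
Qed.

Lemma MC_cocycle chi psi :
  [pchar K] =i pred0 -> Z2nab chi psi -> MC (cocycle_cochain chi psi).
Proof.
move=> charK0 Z; have Z0 := normalized_cocycle_map Z.
split; first exact: dgla_deg_homog (dgla_component_cocycle Z).
rewrite /nr_diff /lie_cochain cocycle_cochainE -/(cochain2 (@lie K (g * h)%type)).
rewrite !nr_bracket_homog //; last exact: normalized_lie.
rewrite -homogZ -homogD -[RHS](@homog0 _ _ 2); congr (homog 2 _).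
apply/funext => l /=; rewrite -[RHS](cocycle_MC_identity (l ord0)
  (l (lift ord0 ord0)) (l ord_max) Z) -!nr_insert11.
rewrite addrfctE !nr_hbracket11; congr (_ + _).
(* In degree 1, [a, a] is twice i_a a, and 2 is invertible in characteristic zero. *)
rewrite -mulr2n -scaler_nat scalerA mulVf ?scale1r //.
by have /pcharf0P -> := charK0.
Qed.

Definition beta_map (beta : g -> h) (x : g * h) : g * h := (0, beta x.1).

Definition beta_cochain (beta : g -> h) : cochains (g * h)%type :=
  homog 0 (cochain1 (beta_map beta)).

End Cocycles.

(** * Ad-nilpotency of the elements of L^0 *)

Section Nilpotency.
Variables (K : fieldType) (g h : lieAlgType K).

Definition h_args n (l : 'I_n -> g * h) := [set i | (l i).1 == 0]%SET.

(* Each ad_beta turns an argument in g into one in h: it maps C^{m,n} to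
   C^{m+1,n-1}, and so lowers by one the number j of arguments in h that
   force P to vanish. *)
Record h_bounded (k j : nat) (P : cochain (g * h)%type k) : Prop := {
  h_bounded_normalized : normalized P;
  h_bounded_fst : forall l, (P l).1 = 0;
  h_bounded_vanish :
    forall l, (j <= #|h_args l|)%N -> P l = 0
}.

Lemma h_bounded0 k j : h_bounded j (0 : cochain (g * h)%type k).
Proof. by []. Qed.

Lemma h_boundedD k j (P Q : cochain (g * h)%type k) :
  h_bounded j P -> h_bounded j Q -> h_bounded j (P + Q).
Proof.
move=> HP HQ; have PQE l : (P + Q) l = P l + Q l by [].
split=> [v i vi0 | l | l jl]; rewrite PQE.
- by rewrite (h_bounded_normalized HP vi0) (h_bounded_normalized HQ vi0) addr0.
- by rewrite /= (h_bounded_fst HP) (h_bounded_fst HQ) addr0.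
- by rewrite (h_bounded_vanish HP jl) (h_bounded_vanish HQ jl) addr0.
Qed.

Lemma h_bounded_leq k j j' (P : cochain (g * h)%type k) :
  (j <= j')%N -> h_bounded j P -> h_bounded j' P.
Proof.
move=> jj' [P0 P1 PZ]; split=> // l j'l.
exact/PZ/(leq_trans jj').
Qed.

Lemma h_bounded_eq0 k (P : cochain (g * h)%type k) : h_bounded 0 P -> P = 0.
Proof. by move=> HP; apply/funext => l; apply: (h_bounded_vanish HP). Qed.

Lemma sum_fst_eq0 (I : Type) (r : seq I) (p : pred I) (F : I -> g * h) :
  (forall i, (F i).1 = 0) -> (\sum_(i <- r | p i) F i).1 = 0.
Proof.
move=> F0; apply: (big_ind (fun u : g * h => u.1 = 0)) => //= u v -> ->.
exact: addr0.
Qed.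

(** The other half of the bracket, beta applied to values of [P], vanishes because [P] takes values
    in [h] and [beta_map] only sees the [g] component. *)
Lemma nr_hbracket_beta k (beta : g -> h) (P : cochain (g * h)%type k) l :
  beta 0 = 0 -> (forall v, (P v).1 = 0) ->
  nr_hbracket k (cochain1 (beta_map beta)) P l =
  \sum_(s : 'S_k.+1 | is_shuffle 1 s) (-1) ^+ s *:
    P (fun j => if j == ord0 then beta_map beta (l (s ord0)) else l (s j)).
Proof.
move=> beta0 P1; rewrite /nr_hbracket [X in _ - _ *: X]big1.
  rewrite scaler0 subr0; apply: eq_bigr => s _; congr (_ *: P _).
  apply/funext => j; rewrite add0n inord_val /cochain1.
  by rewrite (_ : inord _ = ord0) //; apply: ord_inj; rewrite inordK.
move=> s _; rewrite /cochain1 /beta_map eqxx P1 beta0.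
exact: scaler0.
Qed.

(** In each summand [beta_map] replaces one argument. If that argument was already in [h], it
    becomes 0 and [P] vanishes by normalization; otherwise the number of arguments in [h] grows by
    one. *)
Lemma h_bounded_ad k j (beta : g -> h) (P : cochain (g * h)%type k) :
  beta 0 = 0 -> h_bounded j P ->
  h_bounded j.-1 (nr_hbracket k (cochain1 (beta_map beta)) P).
Proof.
move=> beta0 [P0 P1 PZ]; split=> [l i li0 | l | l jl]; rewrite nr_hbracket_beta //.
- apply: big1 => s _; have [i0|i0] := eqVneq ((s^-1)%g i) ord0.
    rewrite (P0 _ ord0) ?scaler0 //=.
    by rewrite -i0 permKV li0 /beta_map beta0.
  by rewrite (P0 _ ((s^-1)%g i)) ?scaler0 //= (negPf i0) permKV.
- by apply: sum_fst_eq0 => s /=; rewrite P1 scaler0.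
apply: big1 => s _; have [s0|s0] := eqVneq (l (s ord0)).1 0.
  by rewrite (P0 _ ord0) ?scaler0 //= /beta_map s0 beta0.
rewrite PZ ?scaler0 //; set Z := h_args l in jl.
(* Positions of the modified tuple known to hold elements of [h]: the old ones moved by [s], and
   position 0, which is new because [l (s ord0)] has a nonzero [g] component. *)
pose Z' := (ord0 |: [set (s^-1)%g i | i in Z])%SET.
have cardZ' : #|Z'| = #|Z|.+1.
  rewrite cardsU1 card_imset ?add1n; last exact: perm_inj.
  suff -> : ord0 \notin [set (s^-1)%g i | i in Z]%SET by [].
  apply/imsetP => -[i iZ i0]; move: iZ.
  by rewrite inE -(permKV s i) -i0 (negPf s0).
(* Bounding [j] by [j.-1.+1] also covers [j = 0]. *)
apply: leq_trans (leqSpred j) _; rewrite (leq_trans (_ : _ <= #|Z'|)%N) //.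
  by rewrite cardZ'.
apply: subset_leq_card; apply/fintype.subsetP => i; rewrite !inE.
case/orP => [/eqP->|/imsetP[i' i'Z ->]]; first by rewrite eqxx.
case: ifP => //= _; rewrite permKV.
by move: i'Z; rewrite inE.
Qed.

Lemma nr_bracket_homog0 (B : cochain (g * h)%type 0) x k :
  (forall i, normalized (x i)) ->
  nr_bracket (homog 0 B) x k = nr_hbracket k B (x k).
Proof.
move=> x0; rewrite /nr_bracket big_ord_recl big1 ?addr0 => [|i _].
  by rewrite homogE /= subn0.
by rewrite homog_neq // nr_hbracket0l.
Qed.

(** Overwriting entry [i] by 0 does not change [v], and [f] is linear in that entry. *)
Lemma alt_multilinear_eq0 (U V : lmodType K) n (f : ('I_n -> U) -> V) v i :
  alt_multilinear f -> v i = 0 -> f v = 0.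
Proof.
case=> lf _ vi0; have := (linear_zmodE (lf v i)).1.1.
congr (f _ = 0); apply: functional_extensionality_dep => j.
by have [<-|ij] := eqVneq i j; rewrite ?dfwithin ?dfwithout.
Qed.

(** At least one slot of [c] is in [g], so [c] vanishes once all [k.+1] arguments lie in [h]. *)
Lemma h_bounded_incl m n k (c : ('I_m.+1 -> g) -> ('I_n -> h) -> h) :
  (m.+1 + n = k.+1)%N -> bicochain c ->
  h_bounded k.+1 (bicochain_incl c : cochain (g * h)%type k).
Proof.
move=> mnk [cl cr]; split=> // [l i li0 | l].
  rewrite /bicochain_incl big1 // => s _.
  pose j := (s^-1)%g i; have ij : i = s j by rewrite permKV.
  (* The zero argument lands either in the [g] block or in the [h] block of the shuffle, and [c] is
     multilinear in each. *)
  have [jm|mj] := ltnP j m.+1.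
    rewrite (alt_multilinear_eq0 (i := Ordinal jm) (cl _)) ?scaler0 //=.
    by rewrite inord_val -ij li0.
  have jn : (j - m.+1 < n)%N by rewrite ltn_subLR // mnk.
  rewrite (alt_multilinear_eq0 (i := Ordinal jn) (cr _)) ?scaler0 //=.
  by rewrite subnKC // inord_val -ij li0.
rewrite -{1}(card_ord k.+1) => Zl; rewrite /bicochain_incl big1 // => s _.
rewrite (alt_multilinear_eq0 (i := ord0) (cl _)) ?scaler0 //.
have : h_args l == [set: 'I_k.+1]%SET.
  by rewrite eqEcard finset.subsetT cardsT.
by move/eqP/finset.setP/(_ (s (inord (ord0 : 'I_m.+1)))); rewrite !inE => /eqP.
Qed.

Lemma h_bounded_dgla k (P : cochain (g * h)%type k) :
  dgla_component P -> h_bounded k.+1 P.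
Proof.
case=> c [cL ->]; apply: big_ind => [||m _]; first exact: h_bounded0.
  exact: h_boundedD.
by apply: h_bounded_incl => //; rewrite addSn subnKC // leq_ord.
Qed.

(** If [x] vanishes from degree [N] on, its other components have arity at most [N]. So [N] bounds
    all of them at once, and each bracket lowers this bound by one. *)
Lemma ad_nilpotent_beta (beta : g -> h) :
  beta 0 = 0 -> ad_nilpotent (beta_cochain beta).
Proof.
move=> beta0 x [Lx [N xN]].
have bounded n : forall k, h_bounded (N - n) (iter n (nr_bracket (beta_cochain beta)) x k).
  elim: n => [|n IHn] k.
    rewrite subn0 /=; have [Nk|kN] := leqP N k; first by rewrite xN.
    exact: h_bounded_leq kN (h_bounded_dgla (Lx k)).
  rewrite iterS nr_bracket_homog0 => [|i]; last exact: h_bounded_normalized (IHn i).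
  by rewrite subnS; apply: h_bounded_ad.
exists N; apply: functional_extensionality_dep => k.
by apply: h_bounded_eq0; rewrite -(subnn N).
Qed.

End Nilpotency.

(** * The gauge action on a cocycle *)

Section Gauge.
Variables (K : fieldType) (g h : lieAlgType K).
Implicit Types (chi : g -> g -> h) (psi : g -> h -> h) (beta : {linear g -> h}).

Lemma fsum_nat2 (V : nmodType) (F : nat -> V) :
  (forall n, F n.+2 = 0) -> \sum_(n \in [set: nat]) F n = F 0 + F 1.
Proof.
move=> F0; rewrite (fsbigE [:: 0; 1]%N) //=.
  by rewrite !big_cons big_nil !mem_setT /= addr0.
by move=> [|[|n]] _.
Qed.

Lemma dgla_deg0_beta beta : dgla_deg 0 (beta_cochain beta).
Proof.
apply: dgla_deg_homog; exists (fun m x _ => beta (x ord0)); split=> [m|].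
  rewrite [m]ord1; split=> [y|x]; last exact: alt_multilinear0.
  by apply: (@alt_multilinear1 _ _ _ beta); exact: linearP.
apply/funext => l; rewrite fct_sumE big_ord_recl big_ord0 addr0.
rewrite /bicochain_incl (@sum_shuffle_full _ 1) odd_perm1 expr0 scale1r perm1.
by rewrite /cochain1 /beta_map [inord _]ord1.
Qed.

Lemma dgla_deg0P (b : cochains (g * h)%type) :
  dgla_deg 0 b -> exists beta, b = beta_cochain beta.
Proof.
move=> [[Lb _] b0]; have [c [cL b0E]] := Lb 0%N.
(* In C^{1,0} the family of arguments in [h] is indexed by an empty type, so the 0 there is a
   dummy. *)
pose f (u : g) := c ord0 (fun=> u) (fun=> 0).
have lf : linear f.
  have dfwithE (v : 'I_1 -> g) u : @dfwith _ (fun=> g) v ord0 u = (fun=> u).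
    by apply/funext => i; rewrite [i]ord1 dfwithin.
  move=> a u v; have [/(_ (fun=> 0))[/(_ (fun=> 0) ord0) cl _] _] := cL ord0.
  by move: (cl a u v); rewrite !dfwithE.
exists (HB.pack f (GRing.isLinear.Build _ _ _ _ f lf) : {linear g -> h}).
apply: functional_extensionality_dep => k; rewrite /beta_cochain.
have [->|k0] := eqVneq k 0%N; last by rewrite b0 // homog_neq.
rewrite homogE b0E; apply/funext => l.
rewrite fct_sumE big_ord_recl big_ord0 addr0.
rewrite /bicochain_incl (@sum_shuffle_full _ 1) odd_perm1 expr0 scale1r.
rewrite /cochain1 /beta_map /= /f; congr (0, c ord0 _ _).
  by apply/funext => i; rewrite perm1 [inord _]ord1.
by apply/funext => -[].
Qed.

Lemma normalized_beta beta : normalized (cochain1 (beta_map beta)).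
Proof. by apply: normalized_cochain1; rewrite /beta_map (linear0 beta). Qed.

Lemma ad_beta_deg1 beta (f : g * h -> g * h -> g * h) :
  normalized (cochain2 f) ->
  nr_bracket (beta_cochain beta) (homog 1 (cochain2 f)) =
  homog 1 (cochain2 (fun x y => f (beta_map beta x) y - f (beta_map beta y) x
                                - beta_map beta (f x y))).
Proof.
by move=> f0; rewrite nr_bracket_homog ?nr_hbracket01 //; apply: normalized_beta.
Qed.

(** This is what stops both series: [beta_map] has values with zero [g] component, so [f] is fed a
    0, and beta kills the values of the cochain, which lie in [h]. *)
Lemma ad_beta_C20 beta (f : g -> g -> h) :
  (forall u, f 0 u = 0) -> (forall u, f u 0 = 0) ->
  nr_bracket (beta_cochain beta)
    (homog 1 (cochain2 (fun x y : g * h => (0, f x.1 y.1) : g * h))) = 0.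
Proof.
move=> f0 f0'; rewrite ad_beta_deg1; last first.
  by apply: normalized_cochain2 => x; rewrite ?f0 ?f0'.
rewrite -[RHS](@homog0 _ _ 1); congr (homog 1 _); apply/funext => l.
apply/eqP; rewrite /cochain2 /beta_map -pair_eqE /=.
by rewrite !f0 (linear0 beta) !subr0 !eqxx.
Qed.

(** Only the [h] slot of [psi] can receive a value of beta, so the result lies in C^{2,0} and a
    second bracket with beta kills it. *)
Lemma ad_beta_cocycle beta chi psi : Z2nab chi psi ->
  nr_bracket (beta_cochain beta) (cocycle_cochain chi psi) =
  homog 1 (cochain2 (fun x y : g * h =>
    (0, psi x.1 (beta y.1) - psi y.1 (beta x.1)) : g * h)).
Proof.
move=> Z; rewrite cocycle_cochainE ad_beta_deg1; last exact: normalized_cocycle_map.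
congr (homog 1 _); apply/funext => l; rewrite /cochain2 /beta_map /cocycle_map /=.
have chi0 u : chi 0 u = 0 by rewrite (linear_zmodE (chi_linearl Z u)).
have psi0 u : psi 0 u = 0 by rewrite (linear_zmodE (psi_linear Z u)).
apply/eqP; rewrite -pair_eqE /= (linear0 beta) !chi0 !psi0 !subr0 !eqxx /=.
by apply/eqP; rewrite !add0r opprK addrC.
Qed.

Lemma nr_diff_beta beta :
  nr_diff (beta_cochain beta) = homog 1 (cochain2 (fun x y : g * h =>
    (0, beta [lie x.1, y.1] - [lie beta x.1, y.2] + [lie beta y.1, x.2]) : g * h)).
Proof.
rewrite /nr_diff /lie_cochain -/(cochain2 (@lie K (g * h)%type)).
rewrite nr_bracket_homog ?nr_hbracket10; first 1 last.
- exact: normalized_lie.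
- exact: normalized_beta.
congr (homog 1 _); apply/funext => l; rewrite /cochain2 /beta_map /=.
apply/eqP; rewrite -pair_eqE /= !lie0x !subr0 !eqxx /=.
by apply/eqP; rewrite opprB addrCA addrC.
Qed.

(** Feeding beta into either slot gives the same term by antisymmetry of the bracket of [h]; the
    resulting factor 2 cancels the coefficient 1/2! in [gauge_term]. *)
Lemma ad_beta_diff beta :
  nr_bracket (beta_cochain beta) (nr_diff (beta_cochain beta)) =
  homog 1 (cochain2 (fun x y : g * h =>
    (0, - ([lie beta x.1, beta y.1] *+ 2)) : g * h)).
Proof.
rewrite nr_diff_beta ad_beta_deg1; last first.
  apply: normalized_cochain2 => x /=.
    by rewrite !lie0x (linear0 beta) !lie0x liex0 subr0 addr0.
  by rewrite !liex0 !(linear0 beta) lie0x subr0 addr0.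
congr (homog 1 _); apply/funext => l; rewrite /cochain2 /beta_map /=.
apply/eqP; rewrite -pair_eqE /= !lie0x !(linear0 beta) !lie0x !subr0 !add0r eqxx /=.
by apply/eqP; rewrite (lieC (beta _)) mulr2n opprD.
Qed.

Lemma iter_ad_beta_eq0 beta x n :
  nr_bracket (beta_cochain beta) (nr_bracket (beta_cochain beta) x) = 0 ->
  iter n.+2 (nr_bracket (beta_cochain beta)) x = 0.
Proof.
move=> ad2; elim: n => [|n IHn]; first exact: ad2.
(* The bracket with 0 is not 0 by computation; 0 is treated as an element of C^{2,0}. *)
rewrite iterS IHn -[X in nr_bracket _ X](@homog0 _ _ 1).
exact: (@ad_beta_C20 beta (fun _ _ => 0)).
Qed.

Lemma exp_ad_cocycle beta chi psi : Z2nab chi psi ->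
  exp_ad (beta_cochain beta) (cocycle_cochain chi psi) =
  homog 1 (cochain2 (fun x y : g * h =>
    (0, chi x.1 y.1 + psi x.1 y.2 - psi y.1 x.2
        + (psi x.1 (beta y.1) - psi y.1 (beta x.1))) : g * h)).
Proof.
move=> Z; rewrite /exp_ad fsum_nat2 => [|n].
  rewrite !invr1 !scale1r /= ad_beta_cocycle // cocycle_cochainE -homogD.
  congr (homog 1 _); apply/funext => l; rewrite /cochain2 /cocycle_map.
  by rewrite addrfctE; apply/eqP; rewrite -pair_eqE /= addr0 !eqxx.
rewrite iter_ad_beta_eq0 ?scaler0 // ad_beta_cocycle //.
apply: (@ad_beta_C20 beta (fun u v => psi u (beta v) - psi v (beta u))) => u.
  rewrite (linear_zmodE (psi_linear Z _)) (linear0 beta).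
  by rewrite (linear_zmodE (psi_der Z _).1) subr0.
rewrite (linear_zmodE (psi_linear Z _)) (linear0 beta).
by rewrite (linear_zmodE (psi_der Z _).1) subr0.
Qed.

Lemma gauge_term_beta beta : [pchar K] =i pred0 ->
  gauge_term (beta_cochain beta) =
  homog 1 (cochain2 (fun x y : g * h =>
    (0, - (beta [lie x.1, y.1] - [lie beta x.1, y.2] + [lie beta y.1, x.2])
        + [lie beta x.1, beta y.1]) : g * h)).
Proof.
move=> charK0; rewrite /gauge_term fsum_nat2 => [|n].
  rewrite [iter 0 _ _]/= [iter 1 _ _]/= ad_beta_diff nr_diff_beta.
  rewrite invr1 scale1r -homogZ -homogD -homogN.
  congr (homog 1 _); apply/funext => l; rewrite /cochain2.
  rewrite addrfctE opprfctE; apply/eqP; rewrite -pair_eqE /= scaler0 addr0 oppr0 eqxx.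
  rewrite /= opprD scalerN opprK -scaler_nat scalerA mulVf ?scale1r //.
  by have /pcharf0P -> := charK0.
rewrite iter_ad_beta_eq0 ?scaler0 // ad_beta_diff.
apply: (@ad_beta_C20 beta (fun u v => - ([lie beta u, beta v] *+ 2))) => u.
  by rewrite (linear0 beta) lie0x mul0rn oppr0.
by rewrite (linear0 beta) liex0 mul0rn oppr0.
Qed.

(** The part of -d beta in C^{1,1} is absorbed into [psi]; the terms with both arguments in [g] are
    collected in [chi]. *)
Lemma gauge_action_cocycle beta chi psi :
  [pchar K] =i pred0 -> Z2nab chi psi ->
  exp_ad (beta_cochain beta) (cocycle_cochain chi psi)
    + gauge_term (beta_cochain beta) =
  cocycle_cochain
    (fun a b => chi a b + psi a (beta b) - psi b (beta a)
                - beta [lie a, b] + [lie beta a, beta b])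
    (fun a x => psi a x + [lie beta a, x]).
Proof.
move=> charK0 Z; rewrite exp_ad_cocycle // gauge_term_beta // -homogD.
congr (homog 1 _); apply/funext => l; rewrite /cochain2 addrfctE.
apply/eqP; rewrite -pair_eqE /= addr0 eqxx /= -subr_eq0; apply/eqP.
by zmod_cancel.
Qed.

End Gauge.

Theorem proposition2p2 (K : fieldType) (charK0 : [pchar K]%R =i pred0)
    (g h : lieAlgType K)
    (chi chi' : g -> g -> h) (psi psi' : g -> h -> h)
    (Hc : Z2nab chi psi) (Hc' : Z2nab chi' psi') :
  Z2nab_equiv chi psi chi' psi' <->
  gauge_equiv (cocycle_cochain chi psi) (cocycle_cochain chi' psi').
Proof.
split=> [[beta [psiE chiE]] | [_ _ [b [Lb _ a'E]]]].
  split; [exact: MC_cocycle | exact: MC_cocycle |].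
  exists (beta_cochain beta); split; first exact: dgla_deg0_beta.
    exact/ad_nilpotent_beta/linear0.
  rewrite gauge_action_cocycle //; congr cocycle_cochain.
    by apply/funext => a; apply/funext => c; apply: chiE.
  by apply/funext => a; apply/funext => x; apply: psiE.
have [beta bE] := dgla_deg0P Lb.
move: a'E; rewrite bE gauge_action_cocycle // => /homog_inj eq_l.
(* The equality of cochains is tested on pairs, and only its [h] component carries information. *)
pose l (x y : g * h) (i : 'I_2) := if i == ord0 then x else y.
have eq_xy x y := congr1 snd (congr1 (@^~ (l x y)) eq_l).
have psi0 u : psi 0 u = 0 by rewrite (linear_zmodE (psi_linear Hc u)).
have psi'0 u : psi' 0 u = 0 by rewrite (linear_zmodE (psi_linear Hc' u)).
have psi00 u : psi u 0 = 0 by rewrite (linear_zmodE (psi_der Hc u).1).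
have psi'00 u : psi' u 0 = 0 by rewrite (linear_zmodE (psi_der Hc' u).1).
have chi0 u : chi u 0 = 0 by rewrite (linear_zmodE (chi_linearr Hc u)).
have chi'0 u : chi' u 0 = 0 by rewrite (linear_zmodE (chi_linearr Hc' u)).
exists beta; split=> [a x | a c].
  (* One argument in [g] and one in [h] kill [chi], [chi'] and the swapped [psi] terms, isolating
     the C^{1,1} part. *)
  have := eq_xy (a, 0) (0, x); rewrite /l /=.
  rewrite chi0 chi'0 psi0 psi'0 psi00 !(linear0 beta) psi00 !liex0 ?(linear0 beta).
  by rewrite !(addr0, subr0, add0r).
(* With both arguments in [g], the terms of C^{1,1} vanish and the formula for [chi'] remains. *)
have := eq_xy (a, 0) (c, 0); rewrite /l /=.
by rewrite !psi'00 !psi00 !liex0 !(addr0, subr0, add0r).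
Qed.
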